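(* Let $f:\mathbb{R}^n\to\mathbb{R}\cup\{\infty\}$ be a proper closed function and $\bar x\in\operatorname{dom}\partial f$. Suppose that $f$ is SDP-representable: there are symmetric matrices $\{A_{00},A_0,A_1,\dots,A_n,B_1,\dots,B_N\}\subset\mathcal{S}^d$ ($d\ge1$, $N\ge1$) with $$\operatorname{epi}f=\Big\{(x,t)\in\mathbb{R}^n\times\mathbb{R}:\ \exists u\in\mathbb{R}^N\text{ s.t. }A_{00}+A_0t+\sum_{i=1}^nA_ix_i+\sum_{j=1}^NB_ju_j\succeq0\Big\}.$$ Let $\mathcal{A}^*(x,u,t):=A_0t+\sum_{i=1}^nA_ix_i+\sum_{j=1}^NB_ju_j$ for $(x,u,t)\in\mathbb{R}^n\times\mathbb{R}^N\times\mathbb{R}$, let $\mathfrak{D}:=\{(x,u,t):A_{00}+\mathcal{A}^*(x,u,t)\succeq0\}$, let $F(x,u,t):=t+\delta_{\mathfrak{D}}(x,u,t)$, and let $\mathfrak{D}_{\bar x}:=\{u\in\mathbb{R}^N:(\bar x,u,f(\bar x))\in\mathfrak{D}\}$. Suppose that: (i) (Slater's condition) there exists $(x^s,u^s,t^s)$ such that $A_{00}+\mathcal{A}^*(x^s,u^s,t^s)\succ0$; (ii) (Compactness) the set $\mathfrak{D}_{\bar x}$ is nonempty and compact; (iii) (Strict complementarity) $0\in\operatorname{ri}\partial F(\bar x,u,f(\bar x))$ for all $u\in\mathfrak{D}_{\bar x}$. Then $f$ satisfies the KL property at $\bar x$ with exponent $\frac12$.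
   Context: $\mathcal{S}^d$ is the space of $d\times d$ real symmetric matrices with the trace inner product; $\succeq0$ (resp. $\succ0$) means positive semidefinite (resp. definite). $\operatorname{epi}f:=\{(x,t):f(x)\le t\}$. $\delta_{D}$ is the indicator function of $D$ ($0$ on $D$, $\infty$ otherwise). $\operatorname{ri}$ is relative interior. A function $h:\mathbb{X}\to\mathbb{R}\cup\{\infty\}$ is proper if $\operatorname{dom}h:=\{x:h(x)<\infty\}\neq\emptyset$, and closed if it is lower semicontinuous. The regular subdifferential of a proper $h$ at $x\in\operatorname{dom}h$ is $\hat\partial h(x)=\{\zeta:\liminf_{z\to x,z\ne x}\frac{h(z)-h(x)-\langle\zeta,z-x\rangle}{\|z-x\|}\ge0\}$; the (limiting) subdifferential is $\partial h(x)=\{\zeta:\exists\,x^k\to x,\ h(x^k)\to h(x),\ \zeta^k\to\zeta,\ \zeta^k\in\hat\partial h(x^k)\}$ (the usual convex subdifferential when $h$ is convex); both are empty for $x\notin\operatorname{dom}h$, and $\operatorname{dom}\partial h:=\{x:\partial h(x)\ne\emptyset\}$. Write $\operatorname{dist}(x,D):=\inf_{y\in D}\|x-y\|$ (with value $\infty$ if $D=\emptyset$). A proper closed $h$ satisfies the Kurdyka-Łojasiewicz (KL) property at $\hat x\in\operatorname{dom}\partial h$ with exponent $\alpha\in[0,1)$ if there exist $a\in(0,\infty]$, a neighborhood $V$ of $\hat x$ and $\bar c>0$ such that, with $\varphi(s)=\bar c s^{1-\alpha}$, $\varphi'(h(x)-h(\hat x))\operatorname{dist}(0,\partial h(x))\ge1$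 for every $x\in V$ with $h(\hat x)<h(x)<h(\hat x)+a$. *)

(* Defs.v *)
From HB Require Import structures.
From mathcomp Require Import all_boot all_order all_algebra.
From mathcomp Require Import all_classical all_reals all_analysis.

Set Implicit Arguments.
Unset Strict Implicit.
Unset Printing Implicit Defensive.

Import Order.TTheory GRing.Theory Num.Theory.
Import numFieldNormedType.Exports.

Local Open Scope classical_set_scope.
Local Open Scope ring_scope.

(* R^m is 'rV[R]_m. The library norm on matrices is the sup norm, so the
   Euclidean structure is defined separately; the library topology on 'rV[R]_m
   is the usual one and is used for neighborhoods, limits and compactness. *)
Definition dotv (R : realType) (m : nat) (u v : 'rV[R]_m) : R :=
  \sum_i u 0 i * v 0 i.

Definition enorm (R : realType) (m : nat) (u : 'rV[R]_m) : R :=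
  Num.sqrt (dotv u u).

(* Infinite when D is empty. *)
Definition dist_set (R : realType) (m : nat) (x : 'rV[R]_m) (D : set 'rV[R]_m) :
  \bar R := ereal_inf [set (enorm (x - y))%:E | y in D].

(* Functions with values in R U {+oo} are functions to \bar R avoiding -oo. *)
Definition proper_fun (R : realType) (m : nat) (h : 'rV[R]_m -> \bar R) : Prop :=
  (forall x, h x != -oo%E) /\ (exists x, (h x < +oo)%E).

Definition closed_fun (R : realType) (m : nat) (h : 'rV[R]_m -> \bar R) : Prop :=
  lower_semicontinuous h.

Definition dom (R : realType) (m : nat) (h : 'rV[R]_m -> \bar R) :
  set 'rV[R]_m := [set x | (h x < +oo)%E].

Definition epi (R : realType) (m : nat) (h : 'rV[R]_m -> \bar R) :
  set ('rV[R]_m * R) := [set p | (h p.1 <= p.2%:E)%E].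

Definition indic_fun (R : realType) (m : nat) (D : set 'rV[R]_m)
  (x : 'rV[R]_m) : \bar R := if x \in D then 0%E else +oo%E.

Definition reg_subdiff (R : realType) (m : nat) (h : 'rV[R]_m -> \bar R)
  (x : 'rV[R]_m) : set 'rV[R]_m :=
  [set zeta | dom h x /\
    (0 <= limf_einf (fun z => (h z - h x - (dotv zeta (z - x))%:E)
                              * ((enorm (z - x))^-1)%:E) x^')%E].

Definition subdiff (R : realType) (m : nat) (h : 'rV[R]_m -> \bar R)
  (x : 'rV[R]_m) : set 'rV[R]_m :=
  [set zeta | dom h x /\
    exists (xk zk : nat -> 'rV[R]_m),
      [/\ xk @ \oo --> x, h (xk k) @[k --> \oo] --> h x, zk @ \oo --> zeta
        & forall k, reg_subdiff h (xk k) (zk k)]].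

Definition dom_subdiff (R : realType) (m : nat) (h : 'rV[R]_m -> \bar R) :
  set 'rV[R]_m := [set x | subdiff h x !=set0].

Definition affine_hull (R : realType) (m : nat) (S : set 'rV[R]_m) :
  set 'rV[R]_m :=
  [set y | exists (k : nat) (p : 'I_k -> 'rV[R]_m) (c : 'I_k -> R),
    [/\ forall i, S (p i), \sum_i c i = 1 & y = \sum_i c i *: p i]].

Definition relint (R : realType) (m : nat) (S : set 'rV[R]_m) :
  set 'rV[R]_m :=
  [set x | S x /\ \forall y \near x, affine_hull S y -> S y].

Definition KL_property (R : realType) (m : nat) (h : 'rV[R]_m -> \bar R)
  (xh : 'rV[R]_m) (alpha : R) : Prop :=
  [/\ proper_fun h, closed_fun h, dom_subdiff h xh, 0 <= alpha < 1
    & exists (a : \bar R) (V : set 'rV[R]_m) (c : R),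
      [/\ (0 < a)%E, nbhs xh V, 0 < c
        & let phi := fun s : R => c * s `^ (1 - alpha) in
          forall x, V x -> (h xh < h x)%E -> (h x < h xh + a)%E ->
            (1 <= (derive1 phi (fine (h x - h xh)))%:E
                  * dist_set 0 (subdiff h x))%E]].

Definition psd (R : realType) (d : nat) (M : 'M[R]_d) : Prop :=
  M^T = M /\ forall v : 'rV[R]_d, 0 <= (v *m M *m v^T) 0 0.

Definition posdef (R : realType) (d : nat) (M : 'M[R]_d) : Prop :=
  M^T = M /\ forall v : 'rV[R]_d, v != 0 -> 0 < (v *m M *m v^T) 0 0.

Definition Astar (R : realType) (n N d : nat) (A0 : 'M[R]_d)
  (A : 'I_n -> 'M[R]_d) (B : 'I_N -> 'M[R]_d)
  (x : 'rV[R]_n) (u : 'rV[R]_N) (t : R) : 'M[R]_d :=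
  t *: A0 + \sum_i x 0 i *: A i + \sum_j u 0 j *: B j.

(* R^n x R^N x R is identified with R^(n + N + 1) by concatenation. *)
Definition triple (R : realType) (n N : nat) (x : 'rV[R]_n) (u : 'rV[R]_N)
  (t : R) : 'rV[R]_(n + N + 1) := row_mx (row_mx x u) t%:M.

Definition xpart (R : realType) (n N : nat) (z : 'rV[R]_(n + N + 1)) :
  'rV[R]_n := lsubmx (lsubmx z).

Definition upart (R : realType) (n N : nat) (z : 'rV[R]_(n + N + 1)) :
  'rV[R]_N := rsubmx (lsubmx z).

Definition tpart (R : realType) (n N : nat) (z : 'rV[R]_(n + N + 1)) : R :=
  (rsubmx z) 0 0.

Definition lmi_set (R : realType) (n N d : nat) (A00 A0 : 'M[R]_d)
  (A : 'I_n -> 'M[R]_d) (B : 'I_N -> 'M[R]_d) : set 'rV[R]_(n + N + 1) :=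
  [set z | psd (A00 + Astar A0 A B (xpart z) (upart z) (tpart z))].

Definition lmi_fun (R : realType) (n N d : nat) (A00 A0 : 'M[R]_d)
  (A : 'I_n -> 'M[R]_d) (B : 'I_N -> 'M[R]_d) (z : 'rV[R]_(n + N + 1)) :
  \bar R := ((tpart z)%:E + indic_fun (lmi_set A00 A0 A B) z)%E.

(* Only used at points where f is finite, so that fine (f xbar) is f(xbar). *)
Definition lmi_fiber (R : realType) (n N d : nat) (A00 A0 : 'M[R]_d)
  (A : 'I_n -> 'M[R]_d) (B : 'I_N -> 'M[R]_d) (f : 'rV[R]_n -> \bar R)
  (xbar : 'rV[R]_n) : set 'rV[R]_N :=
  [set u | lmi_set A00 A0 A B (triple xbar u (fine (f xbar)))].

(* Main.v *)
Require Import Defs.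
From HB Require Import structures.
From mathcomp Require Import all_boot all_order all_algebra.
From mathcomp Require Import all_classical all_reals all_analysis.
From mathcomp Require Import ssrAC ring lra.
Import Order.TTheory GRing.Theory Num.Theory.
Import numFieldNormedType.Exports.
Local Open Scope classical_set_scope.
Local Open Scope ring_scope.

(* Strict complementarity yields a linear growth estimate on the feasible set,
   directly and without duality.  Let M be the matrix of the LMI at an optimal
   point zb = (xbar, ub, f xbar) and let the rows of P span ker M.  For
   z = zb + w put y0(w) = t(w) - tr(P A*(w) P^T).  Since P M = 0, y0 is a
   subgradient of F at zb, and as 0 lies in the relative interior of dF(zb), so
   is - eps y0 for some eps > 0; this says t - f xbar >= c tr(P M(z) P^T) for
   all feasible z, with c = eps / (1 + eps).

   Cauchy-Schwarz for the psd matrix M(z) then gives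
   |P M(z)| = O(sqrt(t - f xbar)) as long as z stays bounded.  The equations
   P M(z') = 0 and t' = f xbar are linear, so z is at distance
   O(sqrt(t - f xbar)) from a solution z', and moving z' slightly towards zb,
   where M is positive definite off ker M, makes it feasible.  Hence
   dist(x, argmin f)^2 = O(f x - f xbar) near xbar, which for a convex f is the
   KL property with exponent 1/2.  Compactness of the fiber over xbar is used
   only to keep u bounded. *)

Set Implicit Arguments.
Unset Strict Implicit.
Unset Printing Implicit Defensive.

(** * Bilinear forms of matrices and the Cauchy-Schwarz inequality *)

Definition bform (R : realType) (d : nat) (M : 'M[R]_d) (u v : 'rV[R]_d) : R :=
  (u *m M *m v^T) 0 0.

Section Bform.
Context (R : realType) (d : nat).
Implicit Types (M S : 'M[R]_d) (u v w : 'rV[R]_d).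

Lemma bformDl M u v w : bform M (u + v) w = bform M u w + bform M v w.
Proof. by rewrite /bform !mulmxDl mxE. Qed.

Lemma bformZl M (c : R) u w : bform M (c *: u) w = c * bform M u w.
Proof. by rewrite /bform -!scalemxAl mxE. Qed.

Lemma bformDr M u v w : bform M w (u + v) = bform M w u + bform M w v.
Proof. by rewrite /bform linearD /= mulmxDr mxE. Qed.

Lemma bformZr M (c : R) u w : bform M w (c *: u) = c * bform M w u.
Proof. by rewrite /bform linearZ /= -scalemxAr mxE. Qed.

Lemma bformDm M S u v : bform (M + S) u v = bform M u v + bform S u v.
Proof. by rewrite /bform mulmxDr mulmxDl mxE. Qed.

Lemma bformZm M (c : R) u v : bform (c *: M) u v = c * bform M u v.
Proof. by rewrite /bform -scalemxAr -scalemxAl mxE. Qed.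

Lemma bform_sum (I : Type) (r : seq I) (F : I -> 'M[R]_d) u v :
  bform (\sum_(i <- r) F i) u v = \sum_(i <- r) bform (F i) u v.
Proof. by rewrite /bform mulmx_sumr mulmx_suml summxE. Qed.

Lemma bformC M u v : M^T = M -> bform M u v = bform M v u.
Proof.
move=> hM; rewrite /bform.
have -> : u *m M *m v^T = (v *m M *m u^T)^T.
  by rewrite !trmx_mul trmxK hM mulmxA.
by rewrite mxE.
Qed.

Lemma bform_delta M i j : bform M (delta_mx 0 i) (delta_mx 0 j) = M i j.
Proof. by rewrite /bform -rowE trmx_delta -colE !mxE. Qed.

(** The form is nonnegative on all combinations of [u] and [v]; suitable coefficients turn this into
    the bound on the discriminant. *)
Lemma psd_cauchy_schwarz M u v : psd M ->
  bform M u v ^+ 2 <= bform M u u * bform M v v.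
Proof.
move=> [hM pM].
have Hq (s t : R) : 0 <= s ^+ 2 * bform M u u + 2 * s * t * bform M u v
    + t ^+ 2 * bform M v v.
  have := pM (s *: u + t *: v); rewrite -/(bform _ _ _).
  rewrite !(bformDl, bformDr, bformZl, bformZr) (bformC v u hM) => H.
  by apply: le_trans H _; rewrite le_eqVlt; apply/orP; left; apply/eqP; ring.
have [a0 c0] : 0 <= bform M u u /\ 0 <= bform M v v by split; apply: pM.
move: (bform M u u) (bform M u v) (bform M v v) a0 c0 Hq; clear pM => a b c a0 c0 Hq.
have [c_eq|c_neq] := eqVneq c 0.
  have [->|b_neq] := eqVneq b 0; first by rewrite expr0n /= mulr_ge0.
  (* For [c = 0] the quadratic at [s = 1] is affine in [t], and this [t] would give it the value
     -1. *)
  have := Hq 1 (- (a + 1) / (2 * b)).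
  rewrite c_eq mulr0 addr0 expr1n mul1r mulr1.
  have -> : 2 * (- (a + 1) / (2 * b)) * b = - (a + 1) by field.
  by rewrite opprD addrA subrr add0r oppr_ge0 ler10.
have c_pos : 0 < c by rewrite lt_def c_neq c0.
have := Hq c (- b).
have -> : c ^+ 2 * a + 2 * c * - b * b + (- b) ^+ 2 * c =
  c * (a * c - b ^+ 2) by ring.
by rewrite pmulr_rge0 // subr_ge0.
Qed.

Lemma trace_conj_bform k M (P : 'M[R]_(k, d)) :
  \tr (P *m M *m P^T) = \sum_i bform M (row i P) (row i P).
Proof.
apply: eq_bigr => i _; rewrite /bform -row_mul tr_row !mxE.
by apply: eq_bigr => j _; rewrite !mxE.
Qed.

End Bform.

(** * Estimates in the sup norm of matrices *)

Section Bounds.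
Context (R : realType).

Lemma mx_coord_le m n (A : 'M[R]_(m, n)) i j : `|A i j| <= `|A|.
Proof.
rewrite [leRHS]/Num.norm /= mx_normrE.
exact: (le_bigmax _ (fun ij : 'I_m * 'I_n => `|A ij.1 ij.2|) (i, j)).
Qed.

Lemma mx_norm_le m n (A : 'M[R]_(m, n)) (b : R) : 0 <= b ->
  (forall i j, `|A i j| <= b) -> `|A| <= b.
Proof.
move=> b0 H; rewrite [leLHS]/Num.norm /= mx_normrE.
by apply/bigmax_leP; split=> // -[i j] _; apply: H.
Qed.

Lemma mulmx_bounded p q (G : 'M[R]_(p, q)) :
  exists2 C : R, 0 < C & forall m (u : 'M[R]_(m, p)), `|u *m G| <= C * `|u|.
Proof.
(* The summand 1 keeps the constant positive even when [p = 0] or [G = 0]. *)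
exists (1 + p%:R * `|G|) => [|m u]; first by rewrite ltr_pwDl ?mulr_ge0.
apply: mx_norm_le => [|i j]; first by rewrite mulr_ge0 // addr_ge0 // mulr_ge0.
rewrite mxE; apply: le_trans (ler_norm_sum _ _ _) _.
apply: (@le_trans _ _ (\sum_(k < p) `|u| * `|G|)).
  by apply: ler_sum => k _; rewrite normrM ler_pM // mx_coord_le.
rewrite sumr_const card_ord -[X in X <= _]mulr_natl mulrDl mul1r.
by apply: ler_wpDl => //; rewrite le_eqVlt; apply/orP; left; apply/eqP; ring.
Qed.

Lemma bform_bounded d (S : 'M[R]_d) (v : 'rV[R]_d) :
  `|bform S v v| <= d%:R ^+ 2 * `|S| * `|v| ^+ 2.
Proof.
rewrite /bform !mxE; apply: le_trans (ler_norm_sum _ _ _) _.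
apply: (@le_trans _ _ (\sum_(k < d) (d%:R * (`|v| * `|S|)) * `|v|)); last first.
  rewrite sumr_const card_ord -[X in X <= _]mulr_natl.
  by rewrite le_eqVlt; apply/orP; left; apply/eqP; ring.
apply: ler_sum => k _; rewrite !mxE normrM ler_pM ?mx_coord_le //.
apply: le_trans (ler_norm_sum _ _ _) _.
apply: (@le_trans _ _ (\sum_(l < d) `|v| * `|S|)).
  by apply: ler_sum => l _; rewrite normrM ler_pM // mx_coord_le.
by rewrite sumr_const card_ord -[X in X <= _]mulr_natl.
Qed.

End Bounds.

(** * Distance to the optimal set from growth on the kernel of a psd matrix *)

Section FacialGrowth.
Context (R : realType).

(** An entry of [P *m M] pairs a row of [P] with a basis vector, so Cauchy-Schwarz bounds its square
    by one term of the trace times a diagonal entry of [M]. *)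
Lemma psd_mulmx_le k d (P : 'M[R]_(k, d)) (M : 'M[R]_d) : psd M ->
  `|P *m M| <= Num.sqrt (`|M| * \tr (P *m M *m P^T)).
Proof.
move=> hM; apply: mx_norm_le => [|i j]; first exact: sqrtr_ge0.
have tr_eq := trace_conj_bform M P.
have row_ge0 l : 0 <= bform M (row l P) (row l P) by apply: (hM.2).
rewrite -sqrtr_sqr ler_sqrt ?sqr_ge0 ?mulr_ge0 //; last first.
  by rewrite tr_eq sumr_ge0.
have -> : (P *m M) i j = bform M (row i P) (delta_mx 0 j).
  by rewrite /bform -row_mul trmx_delta -colE !mxE.
apply: le_trans (psd_cauchy_schwarz _ _ hM) _.
rewrite mulrC ler_pM //; first exact: (hM.2).
  by rewrite bform_delta; apply: le_trans (ler_norm _) (mx_coord_le _ _ _).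
by rewrite tr_eq (bigD1 i) //= lerDl sumr_ge0.
Qed.

(** [psd_mulmx_le] with [P = v] controls [v *m M] by the form; the bounded map [pinvmx M] then
    recovers the component of [v] off the kernel. *)
Lemma psd_coercive d (M : 'M[R]_d) : psd M ->
  exists2 lam : R, 0 < lam & forall v : 'rV[R]_d,
    lam * `|v *m (M *m pinvmx M)| ^+ 2 <= bform M v v.
Proof.
move=> hM; have [C C_gt0 hC] := mulmx_bounded (pinvmx M).
have D_gt0 : 0 < C ^+ 2 * (`|M| + 1) by rewrite mulr_gt0 ?exprn_gt0 // ltr_wpDl.
exists (C ^+ 2 * (`|M| + 1))^-1 => [|v]; first by rewrite invr_gt0.
rewrite mulmxA ler_pdivrMl //.
have q_ge0 : 0 <= bform M v v by apply: (hM.2).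
have vM_le : `|v *m M| ^+ 2 <= `|M| * bform M v v.
  have := psd_mulmx_le v hM; rewrite trace_mx11 -/(bform M v v) => H.
  rewrite -[leRHS]sqr_sqrtr ?mulr_ge0 //.
  by rewrite ler_pXn2r ?nnegrE ?sqrtr_ge0.
apply: (@le_trans _ _ ((C * `|v *m M|) ^+ 2)).
  by rewrite ler_pXn2r ?nnegrE ?mulr_ge0 // ltW.
rewrite exprMn -[leRHS]mulrA ler_wpM2l ?exprn_ge0 ?(ltW C_gt0) //.
by apply: le_trans vM_le _; rewrite mulrDl mul1r lerDl.
Qed.

(* [M *m pinvmx M] projects onto a complement of the kernel of [M]. *)
Lemma bform_ker_proj d (M S : 'M[R]_d) (v : 'rV[R]_d) : S^T = S ->
  kermx M *m S = 0 ->
  bform S v v = bform S (v *m (M *m pinvmx M)) (v *m (M *m pinvmx M)).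
Proof.
move=> hS kS; set w := v *m _.
have /submxP [a ha] : (v - w <= kermx M)%MS.
  by apply/sub_kermxP; rewrite mulmxBl /w mulmxA mulmxKpV ?submxMl ?subrr.
have vwS : (v - w) *m S = 0 by rewrite ha -mulmxA kS mulmx0.
have step x : bform S v x = bform S w x.
  by rewrite -[v](subrK w) bformDl /bform vwS mul0mx mxE add0r.
by rewrite step bformC // step.
Qed.

(** Here [w] is a displacement from a point with matrix [M], and [w *m e] is the change of the
    objective. Correcting [w] so that it solves the linear equations costs O(sqrt(w e)); a pull
    towards 0 of the same order restores feasibility, because [M] is coercive off its kernel. *)
Lemma facial_growth m d (M : 'M[R]_d) (L : {linear 'rV[R]_m -> 'M[R]_d})
    (e : 'cV[R]_m) (c K : R) :
  psd M -> (forall w, (L w)^T = L w) -> 0 < c -> 0 <= K ->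
  (forall w, psd (M + L w) ->
     c * \tr (kermx M *m (M + L w) *m (kermx M)^T) <= (w *m e) 0 0) ->
  exists a C : R, [/\ 0 < a, 0 < C & forall w,
    psd (M + L w) -> `|w| <= K -> (w *m e) 0 0 <= a ->
    exists w', [/\ psd (M + L w'), (w' *m e) 0 0 = 0 &
      `|w - w'| <= C * Num.sqrt ((w *m e) 0 0)]].
Proof.
move=> hM symL c_gt0 K_ge0 growth; set P := kermx M in growth *.
have PM : P *m M = 0 by apply: mulmx_ker.
pose W := lin1_mx (mxvec \o (mulmx P \o L)).
have WE w : w *m W = mxvec (P *m L w) by rewrite mul_rV_lin1.
(* [w *m G = 0] encodes the equations [P *m L w = 0] and [w *m e = 0] together. *)
pose G := row_mx W e.
have GE k (w : 'M[R]_(k, m)) : w *m G = row_mx (w *m W) (w *m e)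
  by exact: mul_mx_row.
have [C1 C1_gt0 hC1] := mulmx_bounded (pinvmx G).
have [CL CL_gt0 hCL] : exists2 C : R, 0 < C & forall w, `|L w| <= C * `|w|.
  have [C C_gt0 hC] := mulmx_bounded (lin1_mx (mxvec \o L)).
  exists C => // w; apply: mx_norm_le => [|i j]; first by rewrite mulr_ge0 // ltW.
  rewrite -(mxvecE (L w)); apply: le_trans (hC 1%N w).
  by rewrite mul_rV_lin1 mx_coord_le.
have [lam lam_gt0 coer] := psd_coercive hM.
(* [K1] bounds the norm of [M + L w] for [w] in the ball of radius [K], [C2] bounds the linear
   correction relative to sqrt(w e), and [C3] is the pull needed per unit of correction; [b] keeps
   this pull at most 1. *)
pose K1 := `|M| + CL * K.
have K1_ge0 : 0 <= K1 by rewrite addr_ge0 // mulr_ge0 // ltW.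
pose C2 := C1 * (Num.sqrt (K1 / c) + 1).
have C2_gt0 : 0 < C2 by rewrite mulr_gt0 // ltr_wpDl // sqrtr_ge0.
pose C3 := d%:R ^+ 2 * CL / lam + 1.
have C3_gt0 : 0 < C3.
  by rewrite ltr_wpDl // divr_ge0 ?mulr_ge0 ?exprn_ge0 // ltW.
pose b := Num.min 1 (C3 * C2)^-1.
have b_gt0 : 0 < b by rewrite lt_min ltr01 invr_gt0 mulr_gt0.
exists (b ^+ 2), ((C3 * K + 1) * C2); split; first exact: exprn_gt0.
  by rewrite mulr_gt0 // ltr_wpDl // mulr_ge0 // ltW.
move=> w psdw wK; set q := (w *m e) 0 0 => qa.
have tr_ge0 : 0 <= \tr (P *m (M + L w) *m P^T).
  by rewrite trace_conj_bform sumr_ge0 // => i _; apply: psdw.2.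
have q_ge0 : 0 <= q by apply: le_trans (growth w psdw); rewrite mulr_ge0 // ltW.
have sq_le : Num.sqrt q <= b.
  by rewrite -(ger0_norm (ltW b_gt0)) -sqrtr_sqr ler_sqrt // exprn_ge0 // ltW.
set sq := Num.sqrt q in sq_le *.
have sq_ge0 : 0 <= sq by apply: sqrtr_ge0.
have q_sq : q = sq ^+ 2 by rewrite sqr_sqrtr.
have [sq1 sq2] : sq <= 1 /\ C3 * C2 * sq <= 1.
  move: sq_le; rewrite /b le_min => /andP[-> H]; split=> //.
  by rewrite -ler_pdivlMl ?mulr_gt0 // mulr1.
(* [r] has the same image as [w] under [G], so [w - r] solves the linear equations, and its size is
   controlled by that of [w *m G]. *)
pose r := w *m G *m pinvmx G.
have rG : r *m G = w *m G by rewrite mulmxKpV // submxMl.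
have [rW re] : P *m L r = P *m L w /\ r *m e = w *m e.
  move: (etrans (esym (GE _ r)) (etrans rG (GE _ w)))
    => /eq_row_mx[]; rewrite !WE => H ->.
  by split=> //; apply: (can_inj mxvecK).
(* The block [P *m L w] equals [P *m (M + L w)] and is controlled by the growth hypothesis; the last
   entry is [q = sq ^+ 2], at most [sq] because [sq <= 1]. *)
have wG_le : `|w *m G| <= (Num.sqrt (K1 / c) + 1) * sq.
  apply: mx_norm_le => [|i j]; first by rewrite mulr_ge0 // addr_ge0 // sqrtr_ge0.
  have PLw : `|P *m L w| <= Num.sqrt (K1 / c) * sq.
    rewrite -[P *m L w]add0r -PM -mulmxDr.
    apply: le_trans (psd_mulmx_le P psdw) _.
    rewrite -sqrtrM ?divr_ge0 ?(ltW c_gt0) //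
      ler_sqrt ?mulr_ge0 ?invr_ge0 ?(ltW c_gt0) //.
    rewrite -mulrA ler_pM //.
      apply: le_trans (ler_normD _ _) _; rewrite lerD2l.
      by apply: le_trans (hCL w) _; rewrite ler_pM2l.
    by rewrite ler_pdivlMl // growth.
  rewrite GE WE mxE mulrDl mul1r; case: splitP => k _.
    apply: ler_wpDr => //; apply: le_trans PLw.
    by case/mxvec_indexP: k => a1 a2; rewrite ord1 mxvecE mx_coord_le.
  rewrite !ord1 ger0_norm // -/q; apply: ler_wpDl.
    by rewrite mulr_ge0 // sqrtr_ge0.
  by rewrite q_sq expr2 ler_piMl.
have r_le : `|r| <= C2 * sq.
  by apply: le_trans (hC1 _ _) _; rewrite /C2 -mulrA ler_pM2l.
pose s := C3 * `|r|.
have s_ge0 : 0 <= s by rewrite mulr_ge0 // ltW.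
have s_le1 : s <= 1.
  by apply: le_trans sq2; rewrite -mulrA ler_pM2l.
(* Pulling [w - r] towards 0 by the fraction [s] brings in the term [s *: M], which will outweigh
   the error caused by [r]. *)
pose w' := (1 - s) *: (w - r).
have ME : M + L w' = s *: M + (1 - s) *: (M + L w + (-1) *: L r).
  rewrite /w' linearZ linearB /= scaleN1r -[in RHS]addrA [in RHS]scalerDr.
  by rewrite addrA -scalerDl (addrC s) subrK scale1r.
exists w'; split.
- split=> [|v]; first by rewrite linearD /= (hM.1) symL.
  rewrite -/(bform _ _ _).
  have sym' : (M + L w')^T = M + L w' by rewrite linearD /= (hM.1) symL.
  (* Since the new matrix also vanishes on ker M, its form need only be tested on the projected
     vector [v1]. *)
  have ker' : P *m (M + L w') = 0.
    rewrite mulmxDr PM add0r /w' linearZ linearB /= -scalemxAr mulmxBr.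
    by rewrite rW subrr scaler0.
  rewrite (bform_ker_proj v sym' ker').
  have := coer v; rewrite (bform_ker_proj v hM.1 PM); set v1 := v *m _ => coerv.
  rewrite ME !(bformDm, bformZm).
  have pos1 := psdw.2 v1; rewrite -/(bform _ _ _) bformDm in pos1.
  have bnd : bform (L r) v1 v1 <= lam * s * `|v1| ^+ 2.
    apply: le_trans (ler_norm _) _; apply: le_trans (bform_bounded _ _) _.
    rewrite ler_wpM2r ?exprn_ge0 //.
    apply: (@le_trans _ _ (d%:R ^+ 2 * (CL * `|r|))).
      by rewrite ler_wpM2l ?exprn_ge0.
    have -> : lam * s = d%:R ^+ 2 * (CL * `|r|) + lam * `|r|.
      by rewrite /s /C3; field; rewrite gt_eqF.
    by rewrite lerDl mulr_ge0 // ltW.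
  rewrite mulN1r mulrDr.
  have := ler_wpM2l s_ge0 coerv.
  have s1_ge0 : 0 <= 1 - s by rewrite subr_ge0.
  have := ler_wpM2l s1_ge0 bnd; have := mulr_ge0 s1_ge0 pos1.
  (* This is the surplus left after adding the three preceding bounds: coercivity with weight [s],
     the other two with weight [1 - s]. *)
  have : 0 <= s * (lam * s * `|v1| ^+ 2).
    by rewrite !mulr_ge0 ?exprn_ge0 // ltW.
  move: (bform M v1 v1) (bform (L w) v1 v1) (bform (L r) v1 v1) => x y z.
  move: `|v1| s {s_ge0 s_le1 w' ME sym' ker' bnd s1_ge0} => nv1 s; clear => *; lra.
- rewrite /w' -scalemxAl mulmxBl re subrr scaler0 mxE //.
(* Both terms are of the order of [r], since [s] is proportional to its norm and [w] is bounded by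
   [K]. *)
have -> : w - w' = s *: w + (1 - s) *: r.
  rewrite /w' scalerBr opprB addrCA -{1}[w]scale1r -scalerBl.
  by rewrite opprB addrCA subrr addr0 addrC.
apply: le_trans (ler_normD _ _) _.
have -> : `|s *: w| = s * `|w| by rewrite normrZ ger0_norm.
have -> : `|(1 - s) *: r| = (1 - s) * `|r| by rewrite normrZ ger0_norm // subr_ge0.
rewrite -[leRHS]mulrA.
apply: (@le_trans _ _ ((C3 * K + 1) * `|r|)); last first.
  by rewrite ler_wpM2l // addr_ge0 // mulr_ge0 // ltW.
rewrite [leRHS]mulrDl [1 * _ in leRHS]mul1r lerD //; last first.
  by rewrite ler_piMl // lerBlDr lerDl.
by rewrite /s mulrAC ler_wpM2r // ler_wpM2l // ltW.
Qed.
End FacialGrowth.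

(** Real upper bounds stand in for the values of [h]: this is convexity of the epigraph, free of
    infinite arithmetic. *)
Definition convex_ereal (R : realType) (m : nat) (h : 'rV[R]_m -> \bar R) : Prop :=
  forall (x y : 'rV[R]_m) (a b s : R), 0 <= s <= 1 ->
    (h x <= a%:E)%E -> (h y <= b%:E)%E ->
    (h ((1 - s) *: x + s *: y)%R <= ((1 - s) * a + s * b)%:E)%E.

(** * Subgradients of convex extended-valued functions *)

Section Subdifferential.
Context (R : realType) (m : nat).
Implicit Types (h : 'rV[R]_m -> \bar R) (x y zeta : 'rV[R]_m).

Lemma dotvZr zeta (c : R) x : dotv zeta (c *: x) = c * dotv zeta x.
Proof. by rewrite /dotv mulr_sumr; apply: eq_bigr => i _; rewrite mxE mulrCA. Qed.

Lemma enormZ (c : R) x : 0 <= c -> enorm (c *: x) = c * enorm x.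
Proof.
move=> c0; rewrite /enorm dotvZr.
have -> : dotv (c *: x) x = c * dotv x x.
  by rewrite /dotv mulr_sumr; apply: eq_bigr => i _; rewrite mxE mulrA.
by rewrite mulrA -expr2 sqrtrM ?sqr_ge0 // sqrtr_sqr ger0_norm.
Qed.

Lemma enorm_ge_coord x i : `|x 0 i| <= enorm x.
Proof.
rewrite -sqrtr_sqr ler_sqrt; last by apply: sumr_ge0 => j _; rewrite -expr2 sqr_ge0.
rewrite /dotv (bigD1 i) //= -expr2 lerDl.
by apply: sumr_ge0 => j _; rewrite -expr2 sqr_ge0.
Qed.

Lemma enorm_gt0 x : x != 0 -> 0 < enorm x.
Proof.
move=> x0; rewrite lt_def sqrtr_ge0 andbT; apply: contraNneq x0 => e0.
apply/eqP/rowP => i; apply/eqP; rewrite mxE -normr_eq0.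
by rewrite eq_le normr_ge0 andbT -e0 enorm_ge_coord.
Qed.

(** The growth estimates use the sup norm of [x]; passing to it coordinatewise costs the factor
    [m]. *)
Lemma dotv_le zeta x : dotv zeta x <= m%:R * enorm zeta * `|x|.
Proof.
apply: (@le_trans _ _ (\sum_(i < m) enorm zeta * `|x|)).
  apply: ler_sum => i _; apply: le_trans (ler_norm _) _.
  by rewrite normrM ler_pM ?enorm_ge_coord ?mx_coord_le.
by rewrite sumr_const card_ord -[X in X <= _]mulr_natl mulrA.
Qed.

(** If the inequality failed at [y], convexity would keep the difference quotients on the segment
    from [x] to [y] below one negative constant, against the sign of the liminf. *)
Lemma reg_subdiff_convex h x zeta y (b : R) : (forall z, h z != -oo%E) ->
  convex_ereal h -> reg_subdiff h x zeta -> (h y <= b%:E)%E ->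
  fine (h x) + dotv zeta (y - x) <= b.
Proof.
move=> hNy cvx [hx liminf_ge0] hy.
have hxE : h x = (fine (h x))%:E.
  by rewrite fineK // fin_real // lt_neqAle eq_sym hNy leNye.
set a := fine (h x) in hxE *.
rewrite leNgt; apply/negP => lt_b.
have yx : y - x != 0.
  apply: contraTneq lt_b; move=> /eqP; rewrite subr_eq0 => /eqP yx.
  rewrite yx subrr -(scale0r 0) dotvZr mul0r addr0 -leNgt -lee_fin -hxE -yx.
  exact: hy.
have e_gt0 := enorm_gt0 yx; set e := enorm (y - x) in e_gt0.
pose c := (b - a - dotv zeta (y - x)) / e.
have c_lt0 : c < 0 by rewrite pmulr_llt0 ?invr_gt0 // -addrA -opprD subr_lt0.
suff : (limf_einf (fun z => (h z - h x - (dotv zeta (z - x))%:E)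
                   * ((enorm (z - x))^-1)%:E) x^' <= c%:E)%E.
  by move=> /(le_trans liminf_ge0); rewrite lee_fin leNgt c_lt0.
(* Every punctured neighborhood of [x] contains a point of the segment, and the quotient there is at
   most [c]. *)
rewrite limf_einfE; apply: ge_ereal_sup => _ [V Vx <-].
have [eps /= eps_gt0 epsV] : exists2 eps : R, 0 < eps &
    forall z, `|z - x| < eps -> z != x -> V z.
  move: Vx; rewrite /dnbhs /within /= => /nbhs_ballP[eps /= eps_gt0 epsV].
  by exists eps => // z zx; apply: epsV; rewrite -ball_normE /ball_ /= distrC.
have n_gt0 : 0 < `|y - x| by rewrite normr_gt0.
pose s := Num.min 1 (eps / (2 * `|y - x|)).
have s_gt0 : 0 < s by rewrite lt_min ltr01 divr_gt0 // mulr_gt0.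
have s_le1 : s <= 1 by rewrite /s ge_min lexx.
have s_eps : s * `|y - x| < eps.
  rewrite -ltr_pdivlMr //; apply: (@le_lt_trans _ _ (eps / (2 * `|y - x|))).
    by rewrite ge_min lexx orbT.
  by rewrite ltr_pM2l // ltf_pV2 ?posrE ?mulr_gt0 // ltr_pMl // ltr1n.
pose z := (1 - s) *: x + s *: y.
have zx : z - x = s *: (y - x).
  by apply/rowP => i; rewrite !mxE; ring.
have hz : (h z <= ((1 - s) * a + s * b)%:E)%E.
  by apply: cvx; rewrite ?hxE ?lexx ?(ltW s_gt0).
have hzE : h z = (fine (h z))%:E.
  by rewrite fineK // fin_real // lt_neqAle eq_sym hNy leNye (le_lt_trans hz) ?ltry.
apply: (@le_trans _ _ ((h z - h x - (dotv zeta (z - x))%:E)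
                   * ((enorm (z - x))^-1)%:E)%E).
  apply: ereal_inf_lbound; exists z => //; apply: epsV.
    by rewrite zx normrZ gtr0_norm.
  by rewrite -subr_eq0 zx scaler_eq0 negb_or gt_eqF.
rewrite hxE hzE zx dotvZr enormZ ?(ltW s_gt0) // -!EFinB -EFinM lee_fin.
rewrite ler_pdivrMr ?mulr_gt0 //.
have -> : c * (s * e) = s * (b - a - dotv zeta (y - x)).
  by rewrite /c; field; rewrite gt_eqF.
move: hz; rewrite hzE lee_fin; move: (fine (h z)) (dotv _ _) => u v.
by clear; move=> /= H; lra.
Qed.

(** The inequality for regular subgradients passes to the limit along the defining sequences, since
    the values [h (xk k)] converge to [h x]. *)
Lemma subdiff_convex h x zeta y (b : R) : (forall z, h z != -oo%E) ->
  convex_ereal h -> subdiff h x zeta -> (h y <= b%:E)%E ->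
  fine (h x) + dotv zeta (y - x) <= b.
Proof.
move=> hNy cvx [hx [xk [zk [xk_x hk_hx zk_z sub]]]] hy.
have hxE : h x = (fine (h x))%:E.
  by rewrite fineK // fin_real // lt_neqAle eq_sym hNy leNye.
rewrite hxE in hk_hx.
have cvg_h : fine (h (xk k)) @[k --> \oo] --> fine (h x) by exact: fine_cvg hk_hx.
have cvg_d : (dotv (zk k) (y - xk k)) @[k --> \oo] --> dotv zeta (y - x).
  apply: (cvg_big add_continuous) => i _; apply: cvgM.
    exact: (cvg_comp _ _ zk_z (@coord_continuous _ 1 m 0 i zeta)).
  have -> : (fun k => (y - xk k) 0 i) = (fun k => y 0 i - xk k 0 i).
    by apply/funext => k; rewrite !mxE.
  rewrite !mxE; apply: cvgB; first exact: cvg_cst.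
  exact: (cvg_comp _ _ xk_x (@coord_continuous _ 1 m 0 i x)).
have lim : (fine (h (xk k)) + dotv (zk k) (y - xk k)) @[k --> \oo]
    --> fine (h x) + dotv zeta (y - x).
  exact: (cvgD cvg_h cvg_d).
have limb : b @[_ --> \oo] --> b by exact: cvg_cst.
apply: (ler_cvg_to lim limb).
by apply: nearW => k; apply: reg_subdiff_convex (sub k) hy.
Qed.

(** A global affine minorant, exact at [x], makes all difference quotients nonnegative, so constant
    sequences suffice. *)
Lemma convex_subgradient_subdiff h x zeta : h x \is a fin_num ->
  (forall z, h x + (dotv zeta (z - x))%:E <= h z)%E -> subdiff h x zeta.
Proof.
move=> hx sub.
have hx_dom : dom h x by rewrite /dom /= -(fineK hx) ltry.
split=> //; exists (fun=> x), (fun=> zeta); split; try exact: cvg_cst.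
move=> _; split=> //.
rewrite limf_einfE; apply: le_ereal_sup_tmp.
(* The whole space serves as the set of the filter: at [z = x] the inverse of 0 is 0, so the
   quotient is nonnegative there too. *)
eexists; first by exists setT; first exact: filterT.
apply: le_ereal_inf_tmp => _ [z _ <-].
apply: mule_ge0; last by rewrite lee_fin invr_ge0 sqrtr_ge0.
have := sub z; rewrite -(fineK hx) -EFinD; move: (fine (h x)) (dotv _ _) => a v.
case: (h z) => [r| |] // H; last by rewrite !addye.
by move: H; rewrite -!EFinB !lee_fin -addrA -opprD subr_ge0.
Qed.

End Subdifferential.

(** * The linear matrix inequality, its feasible set and its fibers *)

Lemma psd_convex (R : realType) d (M S : 'M[R]_d) (s : R) : 0 <= s <= 1 ->
  psd M -> psd S -> psd ((1 - s) *: M + s *: S).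
Proof.
move=> /andP[s0 s1] [hM pM] [hS pS]; split=> [|v].
  by rewrite linearD !linearZ /= hM hS.
rewrite -/(bform _ v v) bformDm !bformZm addr_ge0 // mulr_ge0 ?subr_ge0 //.
  exact: pM.
exact: pS.
Qed.

Lemma linear_form_dotv (R : realType) m (phi : 'rV[R]_m -> R) :
  (forall (a : R) u v, phi (a *: u + v) = a * phi u + phi v) ->
  exists y : 'rV[R]_m, forall v, dotv y v = phi v.
Proof.
move=> hphi.
have phi0 : phi 0 = 0.
  by have := hphi (-1) 0 0; rewrite scaler0 addr0 mulN1r addNr.
exists (\row_i phi (delta_mx 0 i)) => v.
rewrite [in RHS](row_sum_delta v) /dotv.
apply: esym; elim/big_rec2: _ => // i a b _ <-.
by rewrite hphi mxE mulrC.
Qed.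

Section LMI.
Context (R : realType) (n N d : nat).
Variables (A00 A0 : 'M[R]_d) (A : 'I_n -> 'M[R]_d) (B : 'I_N -> 'M[R]_d).
Hypotheses (hA00 : A00^T = A00) (hA0 : A0^T = A0).
Hypotheses (hA : forall i, (A i)^T = A i) (hB : forall j, (B j)^T = B j).

Lemma xpart_triple (x : 'rV[R]_n) (u : 'rV[R]_N) t : xpart (triple x u t) = x.
Proof. by rewrite /xpart /triple row_mxKl row_mxKl. Qed.

Lemma upart_triple (x : 'rV[R]_n) (u : 'rV[R]_N) t : upart (triple x u t) = u.
Proof. by rewrite /upart /triple row_mxKl row_mxKr. Qed.

Lemma tpart_triple (x : 'rV[R]_n) (u : 'rV[R]_N) t : tpart (triple x u t) = t.
Proof. by rewrite /tpart /triple row_mxKr mxE eqxx mulr1n. Qed.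

Lemma triple_eta (z : 'rV[R]_(n + N + 1)) : triple (xpart z) (upart z) (tpart z) = z.
Proof. by rewrite /triple /xpart /upart /tpart -mx11_scalar !hsubmxK. Qed.

Lemma triple_lin (a : R) (x y : 'rV[R]_n) (u v : 'rV[R]_N) s t :
  triple (a *: x + y) (a *: u + v) (a * s + t) = a *: triple x u s + triple y v t.
Proof.
rewrite /triple !(scale_row_mx, add_row_mx); congr (row_mx _ _).
by apply/rowP => i; rewrite !mxE !ord1 !mulr1n.
Qed.

Lemma triple_convex (x y : 'rV[R]_n) (u v : 'rV[R]_N) (s a b : R) :
  (1 - s) *: triple x u a + s *: triple y v b =
  triple ((1 - s) *: x + s *: y) ((1 - s) *: u + s *: v) ((1 - s) * a + s * b).
Proof.
rewrite triple_lin; congr (_ + _).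
have triple0 : triple (0 : 'rV[R]_n) (0 : 'rV[R]_N) 0 = 0.
  by rewrite /triple raddf0 !row_mx0.
by have := triple_lin s y 0 v 0 b 0; rewrite triple0 !addr0.
Qed.

Definition lmi_map (z : 'rV[R]_(n + N + 1)) : 'M[R]_d :=
  Astar A0 A B (xpart z) (upart z) (tpart z).

Lemma xpartP (a : R) (z w : 'rV[R]_(n + N + 1)) :
  xpart (a *: z + w) = a *: xpart z + xpart w.
Proof. by rewrite /xpart !linearP. Qed.

Lemma upartP (a : R) (z w : 'rV[R]_(n + N + 1)) :
  upart (a *: z + w) = a *: upart z + upart w.
Proof. by rewrite /upart !linearP. Qed.

Lemma tpartP (a : R) (z w : 'rV[R]_(n + N + 1)) :
  tpart (a *: z + w) = a * tpart z + tpart w.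
Proof. by rewrite /tpart !mxE. Qed.

Lemma lmi_map_linear : linear lmi_map.
Proof.
move=> a z w; have coordP k (u v : 'rV[R]_k) i :
    (a *: u + v) 0 i = a * u 0 i + v 0 i.
  by rewrite !mxE.
rewrite /lmi_map /Astar xpartP upartP tpartP.
under eq_bigr => i _ do rewrite coordP scalerDl -scalerA.
under [X in _ + X = _]eq_bigr => i _ do rewrite coordP scalerDl -scalerA.
rewrite !big_split -!scaler_sumr /= scalerDl -scalerA !scalerDr.
by rewrite (AC (2*2*2) ((1*3*5)*(2*4*6))).
Qed.

HB.instance Definition _ := GRing.isLinear.Build R 'rV[R]_(n + N + 1) 'M[R]_d _
  lmi_map lmi_map_linear.

Lemma lmi_map_sym z : (lmi_map z)^T = lmi_map z.
Proof.
rewrite /lmi_map /Astar !linearD /= linearZ /= hA0 !linear_sum /=.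
congr (_ + _ + _); apply: eq_bigr => i _; rewrite linearZ /= ?hA ?hB //.
Qed.

Notation Fun := (lmi_fun A00 A0 A B).
Notation Feas := (lmi_set A00 A0 A B).

Lemma lmi_setE z : Feas z <-> psd (A00 + lmi_map z).
Proof. by []. Qed.

Lemma lmi_set_convex z w (s : R) : 0 <= s <= 1 -> Feas z -> Feas w ->
  Feas ((1 - s) *: z + s *: w).
Proof.
rewrite !lmi_setE => s01 hz hw; have := psd_convex s01 hz hw.
suff -> : A00 + lmi_map ((1 - s) *: z + s *: w) =
  (1 - s) *: (A00 + lmi_map z) + s *: (A00 + lmi_map w) by [].
by rewrite linearP linearZ (scalerDr _ A00) (scalerDr s A00) addrACA -scalerDl
  subrK scale1r.
Qed.

Lemma lmi_fun_le z (a : R) : (Fun z <= a%:E)%E <-> Feas z /\ tpart z <= a.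
Proof.
rewrite /lmi_fun /indic_fun; case: ifPn => [|]; [rewrite inE => hz|move=> hz].
  by rewrite adde0 lee_fin; split=> [|[]].
by split=> [|[hz' _]]; [rewrite addey // | case/negP: hz; rewrite inE].
Qed.

Lemma lmi_fun_feas z : Feas z -> Fun z = (tpart z)%:E.
Proof. by move=> hz; rewrite /lmi_fun /indic_fun mem_set // adde0. Qed.

Lemma lmi_fun_neqNy z : Fun z != -oo%E.
Proof. by rewrite /lmi_fun /indic_fun; case: ifP => _; rewrite ?adde0 ?addey. Qed.

Lemma lmi_fun_convex : convex_ereal Fun.
Proof.
move=> x y a b s s01 /lmi_fun_le[hx xa] /lmi_fun_le[hy yb].
apply/lmi_fun_le; split; first exact: lmi_set_convex.
have [s0 s1] := andP s01.
have -> : tpart ((1 - s) *: x + s *: y) = (1 - s) * tpart x + s * tpart y.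
  by rewrite tpartP /tpart !mxE.
by apply: lerD; apply: ler_wpM2l; rewrite ?subr_ge0.
Qed.

(** The trace is nonnegative on feasible displacements, which makes [y0] a subgradient; the relative
    interior supplies a small negative multiple of it, whose subgradient inequality is the claim. *)
Lemma relint_trace_growth (zb : 'rV[R]_(n + N + 1)) :
  Feas zb -> relint (subdiff Fun zb) 0 ->
  let M := A00 + lmi_map zb in
  exists2 c : R, 0 < c & forall w, psd (M + lmi_map w) ->
    c * \tr (kermx M *m (M + lmi_map w) *m (kermx M)^T) <= tpart w.
Proof.
move=> zbF [sub0 ri0] M; set P := kermx M.
have PM : P *m M = 0 by apply: mulmx_ker.
have tr_eq w : \tr (P *m (M + lmi_map w) *m P^T) = \tr (P *m lmi_map w *m P^T).
  by rewrite mulmxDr PM add0r.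
have [y0 y0E] : exists y, forall v : 'rV[R]_(n + N + 1),
    dotv y v = tpart v - \tr (P *m lmi_map v *m P^T).
  apply: linear_form_dotv => a u v; rewrite tpartP linearP /=.
  rewrite mulmxDr mulmxDl -scalemxAr -scalemxAl linearP /=.
  by rewrite mulrBr opprD addrACA.
have feasD w : Feas (zb + w) <-> psd (M + lmi_map w).
  by rewrite lmi_setE linearD addrA.
have tpartD w : tpart (zb + w) = tpart zb + tpart w.
  by rewrite -[zb]scale1r tpartP mul1r scale1r.
have y0S : subdiff Fun zb y0.
  apply: convex_subgradient_subdiff => [|z]; first by rewrite lmi_fun_feas.
  rewrite -{2}(subrKC zb z); set w := z - zb.
  have [hz|hz] := pselect (Feas (zb + w)); last first.
    suff -> : Fun (zb + w) = +oo%E by rewrite leey.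
    by rewrite /lmi_fun /indic_fun memNset // addey.
  rewrite !lmi_fun_feas // -EFinD lee_fin y0E tpartD lerD2l lerBlDr lerDl.
  rewrite -tr_eq trace_conj_bform sumr_ge0 // => i _.
  by apply: ((feasD w).1 hz).2.
have [eps eps_gt0 epsS] : exists2 eps : R, 0 < eps & subdiff Fun zb (- eps *: y0).
  move: ri0; rewrite -nearE => /nbhs_ballP[eta /= eta_gt0 etaS].
  (* This puts [- eps *: y0] in the ball of radius [eta]; it lies in the affine hull as the
     combination of the subgradients 0 and [y0] with weights [1 + eps] and [- eps]. *)
  pose eps := eta / (`|y0| + 1).
  have n_gt0 : 0 < `|y0| + 1 by rewrite ltr_wpDl.
  have eps_gt0 : 0 < eps by rewrite divr_gt0.
  exists eps => //; apply: etaS.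
    rewrite -ball_normE /ball_ /= sub0r normrN scaleNr normrN normrZ gtr0_norm //.
    by rewrite /eps mulrAC ltr_pdivrMr // ltr_pM2l // ltrDl.
  exists 2%N, (fun i : 'I_2 => if i == 0 then 0 else y0),
    (fun i : 'I_2 => if i == 0 then 1 + eps else - eps); split.
  - by move=> i; case: ifP.
  - by rewrite !big_ord_recl big_ord0 /= addr0 addrK.
  - by rewrite !big_ord_recl big_ord0 /= addr0 scaler0 add0r.
exists (eps / (1 + eps)) => [|w hw]; first by rewrite divr_gt0 // addr_gt0.
have hz : (Fun (zb + w) <= (tpart (zb + w))%:E)%E.
  by apply/lmi_fun_le; rewrite lexx; split=> //; apply/feasD.
(* With T the trace, this becomes [- eps * (tpart w - T) <= tpart w], that is,
   [eps * T <= (1 + eps) * tpart w]. *)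
have := subdiff_convex lmi_fun_neqNy lmi_fun_convex epsS hz.
rewrite lmi_fun_feas //= tpartD lerD2l addrAC subrr add0r.
have -> : dotv (- eps *: y0) w = - eps * dotv y0 w.
  by rewrite /dotv mulr_sumr; apply: eq_bigr => i _; rewrite mxE mulrA.
rewrite y0E tr_eq mulrAC ler_pdivrMr ?addr_gt0 //.
move: (tpart w) (\tr _) => a b; rewrite -subr_ge0 => H; rewrite -subr_ge0.
by apply: le_trans H _; rewrite le_eqVlt; apply/orP; left; apply/eqP; ring.
Qed.

Lemma cvg_bform_Astar (T : Type) (F : set_system T) {FF : Filter F}
    (X : T -> 'rV[R]_n) (U : T -> 'rV[R]_N) (t : T -> R) x u t0 (v : 'rV[R]_d) :
  X z @[z --> F] --> x -> U z @[z --> F] --> u -> t z @[z --> F] --> t0 ->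
  bform (A00 + Astar A0 A B (X z) (U z) (t z)) v v @[z --> F] -->
  bform (A00 + Astar A0 A B x u t0) v v.
Proof.
move=> Xx Uu tt0.
have bE y w s : bform (A00 + Astar A0 A B y w s) v v = bform A00 v v +
    (s * bform A0 v v + \sum_i y 0 i * bform (A i) v v
     + \sum_j w 0 j * bform (B j) v v).
  rewrite /Astar !bformDm bformZm !bform_sum.
  by congr (_ + (_ + _ + _)); apply: eq_bigr => k _; rewrite bformZm.
rewrite bE; under eq_cvg do rewrite bE.
apply: cvgD; first exact: cvg_cst.
apply: cvgD; first apply: cvgD.
- by apply: cvgM => //; exact: cvg_cst.
- apply: (cvg_big add_continuous) => i _; apply: cvgM; last exact: cvg_cst.
  exact: (cvg_comp _ _ Xx (@coord_continuous _ 1 n 0 i x)).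
- apply: (cvg_big add_continuous) => i _; apply: cvgM; last exact: cvg_cst.
  exact: (cvg_comp _ _ Uu (@coord_continuous _ 1 N 0 i u)).
Qed.

(** A sphere around [ub] that encloses the fiber misses it, and by compactness misses all nearby
    fibers. A feasible point beyond the sphere would be joined to the base point by a feasible
    segment crossing it. *)
Lemma lmi_fiber_bounded (xb : 'rV[R]_n) (ub : 'rV[R]_N) (tb : R) :
  Feas (triple xb ub tb) -> compact [set u | Feas (triple xb u tb)] ->
  exists K eps : R, 0 < eps /\ forall x u t, `|x - xb| < eps -> `|t - tb| < eps ->
    Feas (triple x u t) -> `|u| <= K.
Proof.
move=> feasb cptb; have [M [_ bndM]] := compact_bounded cptb.
(* On the sphere of radius [rho] around [ub] the norm of [u] exceeds the bound on the fiber. *)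
pose rho := `|ub| + `|M| + 2.
have rho_gt0 : 0 < rho by rewrite ltr_wpDl ?addr_ge0.
have far u : `|u - ub| = rho -> ~ Feas (triple xb u tb).
  move=> urho uF; have := bndM (`|M| + 1) _ u uF.
  rewrite (le_lt_trans (ler_norm M)) ?ltrDl // => /(_ isT) uM.
  have := ler_normB u ub; rewrite urho leNgt => /negP; apply.
  apply: (@le_lt_trans _ _ (`|M| + 1 + `|ub|)); first by rewrite lerD2r.
  by rewrite /rho addrC addrA ltrD2l ltr1n.
have cptS : compact [set u : 'rV[R]_N | `|u - ub| = rho].
  apply: bounded_closed_compact.
    exists (`|ub| + rho); split=> [|K K_gt u /= urho]; first exact: num_real.
    by rewrite -(subrK ub u) (le_trans (ler_normD _ _)) // urho addrC ltW.
  have cont : continuous (fun u : 'rV[R]_N => `|u - ub|).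
    move=> u; apply: (@cvg_norm _ _ _ (nbhs u)).
    exact: (@cvgB _ _ _ (nbhs u) _ id (fun=> ub) u ub (fun _ => id) (cvg_cst _)).
  apply: (@preimage_closed _ _ _ [set rho] (fun u _ => cont u)).
  exact: closed_eq.
have far_near : \forall p \near (xb, tb), forall u, `|u - ub| = rho ->
    ~ Feas (triple p.1 u p.2).
  (* By compactness of the sphere, infeasibility need only be shown to persist around each of its
     points. *)
  have [+ _] := compact_near_coveringP [set u : 'rV[R]_N | `|u - ub| = rho].
  move=> /(_ cptS _ (nbhs (xb, tb))
    (fun p u => ~ Feas (triple p.1 u p.2))); apply=> u /far uF.
  (* Infeasibility is witnessed by a single vector with a negative value of the form, which is an
     open condition. *)
  have [v v_lt0] : exists v, bform (A00 + lmi_map (triple xb u tb)) v v < 0.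
    apply: contrapT => H; apply: uF; rewrite lmi_setE; split=> [|v].
      by rewrite linearD /= hA00 lmi_map_sym.
    by rewrite leNgt; apply/negP => Hv; apply: H; exists v.
  pose g (z : 'rV[R]_N * ('rV[R]_n * R)) :=
    bform (A00 + Astar A0 A B z.2.1 z.1 z.2.2) v v.
  have gcont : g z @[z --> (u, (xb, tb))] --> g (u, (xb, tb)).
    apply: (@cvg_bform_Astar _ (nbhs (u, (xb, tb))) _
      (fun z => z.2.1) (fun z => z.1) (fun z => z.2.2)).
    - exact: (cvg_comp _ _ (@cvg_snd _ _ (nbhs u) (nbhs (xb, tb)) _)
        (@cvg_fst _ _ (nbhs xb) (nbhs tb) _)).
    - exact: (@cvg_fst _ _ (nbhs u) (nbhs (xb, tb)) _).
    - exact: (cvg_comp _ _ (@cvg_snd _ _ (nbhs u) (nbhs (xb, tb)) _)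
        (@cvg_snd _ _ (nbhs xb) (nbhs tb) _)).
  have g_lt0 : g (u, (xb, tb)) < 0.
    by move: v_lt0; rewrite /lmi_map xpart_triple upart_triple tpart_triple.
  near=> z.
  have : g z < 0 by near: z; exact: (cvgr_lt _ gcont _ g_lt0).
  move=> gz [_ /(_ v)].
  rewrite xpart_triple upart_triple tpart_triple leNgt => /negP; apply.
  exact: gz.
have [eps /= eps_gt0 epsP] : exists2 eps : R, 0 < eps & forall x u t,
    `|x - xb| < eps -> `|t - tb| < eps -> `|u - ub| = rho -> ~ Feas (triple x u t).
  have /nbhs_ballP[eps /= eps_gt0 epsP] := far_near.
  exists eps => // x u t xeps teps; apply: (epsP (x, t)).
  by split; rewrite -ball_normE /ball_ /= distrC.
exists (`|ub| + rho), eps; split=> // x u t xeps teps uF.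
have [u_near|u_far] := leP (`|u - ub|) rho.
  by rewrite -(subrK ub u) (le_trans (ler_normD _ _)) // addrC lerD2l.
exfalso.
have u_gt0 := lt_trans rho_gt0 u_far.
(* This [s] puts the point of the segment exactly on the sphere, while its other coordinates stay
   within [eps] of the base point. *)
pose s := rho / `|u - ub|.
have s_ge0 : 0 <= s by rewrite divr_ge0 // ltW.
have s_le1 : s <= 1 by rewrite ler_pdivrMr // mul1r ltW.
have segE k (a b : 'rV[R]_k) : (1 - s) *: a + s *: b - a = s *: (b - a).
  by apply/rowP => i; rewrite !mxE; ring.
have := lmi_set_convex (s := s) _ feasb uF; rewrite s_ge0 s_le1 => /(_ isT).
rewrite triple_convex; apply: epsP.
- by rewrite segE normrZ ger0_norm // (le_lt_trans _ xeps) // ler_piMl.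
- have -> : (1 - s) * tb + s * t - tb = s * (t - tb) by ring.
  by rewrite normrM ger0_norm // (le_lt_trans _ teps) // ler_piMl.
- by rewrite segE normrZ ger0_norm // /s divfK // gt_eqF.
Unshelve. all: by end_near. Qed.

End LMI.

(** * From growth to the KL inequality *)

Lemma enormN (R : realType) m (x : 'rV[R]_m) : enorm (- x) = enorm x.
Proof.
by congr Num.sqrt; apply: eq_bigr => i _; rewrite !mxE mulrNN.
Qed.

Lemma derive1_scaled_sqrt (R : realType) (c s : R) : 0 < s ->
  derive1 (fun s : R => c * s `^ (1 - 1 / 2)) s = c / 2 / Num.sqrt s.
Proof.
move=> s0; rewrite derive1E.
have /@derive_val H := is_derive1_powR (1 - 1 / 2 : R) s0.
rewrite deriveZ; last by apply: @ex_derive; exact: is_derive1_powR.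
rewrite H.
have -> : 1 - 1 / 2 - 1 = - 2^-1 :> R by field.
rewrite powRN powR12_sqrt ?ltW //.
have -> : 1 - 1 / 2 = 2^-1 :> R by field.
by rewrite [LHS]/GRing.scale /= !mulrA.
Qed.

(** With s = t - f(xb), the subgradient inequality between [x] and the growth point [y] gives s <=
    <zeta, x - y> <= m |zeta| C sqrt(s); dividing by sqrt(s) bounds every subgradient from below. *)
Lemma KL_half_of_growth (R : realType) m (f : 'rV[R]_m -> \bar R) (xb : 'rV[R]_m)
    (C eps : R) :
  proper_fun f -> closed_fun f -> dom_subdiff f xb -> convex_ereal f ->
  0 < C -> 0 < eps ->
  (forall x (t : R), `|x - xb| < eps -> f x = t%:E -> fine (f xb) < t ->
     t < fine (f xb) + eps ->
     exists2 y, (f y <= f xb)%E & `|x - y| <= C * Num.sqrt (t - fine (f xb))) ->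
  KL_property f xb (1 / 2).
Proof.
move=> fprop fclos xdom fcvx C0 eps0 growth.
have fNy := fprop.1.
have fxb : f xb = (fine (f xb))%:E.
  have [z [fdom _]] := xdom.
  by rewrite fineK // fin_real // lt_neqAle eq_sym fNy leNye.
split=> //; first by apply/andP; split; lra.
(* The factor 2 cancels the exponent 1/2 in the derivative of [phi]; the added 1 keeps the constant
   positive when [m = 0]. *)
exists eps%:E, (ball xb eps), (2 * (m%:R * C + 1)); split.
- by rewrite lte_fin.
- exact: nbhsx_ballx.
- by rewrite mulr_gt0 // ltr_wpDl // mulr_ge0 // ltW.
move=> phi x; rewrite -ball_normE /ball_ /= distrC => xeps fx_gt fx_lt.
have fxE : f x = (fine (f x))%:E.
  rewrite fineK // fin_real // lt_neqAle eq_sym fNy leNye /=.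
  by apply: (lt_trans fx_lt); rewrite fxb -EFinD ltry.
rewrite fxb fxE -EFinD !lte_fin in fx_gt fx_lt *.
set tb := fine (f xb) in fxb fx_gt fx_lt growth *.
set t := fine (f x) in fxE fx_gt fx_lt *.
have s_gt0 : 0 < t - tb by rewrite subr_gt0.
rewrite -EFinB /= /phi derive1_scaled_sqrt //.
set s := t - tb in s_gt0 *.
have sq_gt0 : 0 < Num.sqrt s by rewrite sqrtr_gt0.
set p := _ / _ / _.
have pE : p = (m%:R * C + 1) / Num.sqrt s by rewrite /p; field; rewrite gt_eqF.
have D_gt0 : 0 < m%:R * C + 1 by rewrite ltr_wpDl // mulr_ge0 // ltW.
have p_gt0 : 0 < p by rewrite pE divr_gt0.
(* Cancelling [p] leaves a lower bound on an infimum, which also covers an empty subdifferential. *)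
have -> : 1%E = (p%:E * (p^-1)%:E)%E :> \bar R by rewrite -EFinM mulfV // gt_eqF.
apply: lee_wpmul2l; first by rewrite lee_fin ltW.
apply: le_ereal_inf_tmp => _ [zeta hzeta <-]; rewrite lee_fin sub0r enormN.
have [y fy xy] := growth x t xeps fxE fx_gt fx_lt.
rewrite fxb in fy.
have := subdiff_convex fNy fcvx hzeta fy; rewrite fxE /= => H.
have s_le : s <= dotv zeta (x - y).
  have -> : dotv zeta (x - y) = - dotv zeta (y - x).
    by rewrite -[x - y]opprB -scaleN1r dotvZr mulN1r.
  by rewrite /s lerBlDr addrC -lerBlDr opprK.
have s_le2 : s <= m%:R * enorm zeta * (C * Num.sqrt s).
  apply: le_trans s_le _; apply: le_trans (dotv_le _ _) _.
  by rewrite ler_wpM2l // mulr_ge0 // sqrtr_ge0.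
have sq_le : Num.sqrt s <= m%:R * C * enorm zeta.
  rewrite -(ler_pM2r sq_gt0) -expr2 sqr_sqrtr ?(ltW s_gt0) //.
  by apply: le_trans s_le2 _; rewrite le_eqVlt; apply/orP; left; apply/eqP; ring.
rewrite pE invf_div ler_pdivrMr // mulrC; apply: le_trans sq_le _.
by rewrite mulrDl mul1r lerDl sqrtr_ge0.
Qed.

(** * SDP-representable functions and the KL exponent *)

Lemma sdp_epi_feasible (R : realType) (n N d : nat)
    (f : 'rV[R]_n -> \bar R) (A00 A0 : 'M[R]_d) (A : 'I_n -> 'M[R]_d)
    (B : 'I_N -> 'M[R]_d) :
  epi f = [set p : 'rV[R]_n * R |
     exists u : 'rV[R]_N, psd (A00 + Astar A0 A B p.1 u p.2)] ->
  forall x (t : R), (f x <= t%:E)%E <->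
    exists u : 'rV[R]_N, lmi_set A00 A0 A B (triple x u t).
Proof.
move=> hepi x t; have -> : is_true (f x <= t%:E)%E = epi f (x, t) by [].
by rewrite hepi; split=> -[u hu]; exists u; move: hu;
  rewrite /lmi_set /= xpart_triple upart_triple tpart_triple.
Qed.

(** The epigraph is a projection of the convex feasible set. *)
Lemma sdp_representable_convex (R : realType) (n N d : nat)
    (f : 'rV[R]_n -> \bar R) (A00 A0 : 'M[R]_d) (A : 'I_n -> 'M[R]_d)
    (B : 'I_N -> 'M[R]_d) :
  epi f = [set p : 'rV[R]_n * R |
     exists u : 'rV[R]_N, psd (A00 + Astar A0 A B p.1 u p.2)] ->
  convex_ereal f.
Proof.
move=> /sdp_epi_feasible epiE x y a b s s01 /epiE[u hu] /epiE[v hv].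
apply/epiE; exists ((1 - s) *: u + s *: v).
have := lmi_set_convex s01 hu hv.
suff -> : (1 - s) *: triple x u a + s *: triple y v b =
  triple ((1 - s) *: x + s *: y) ((1 - s) *: u + s *: v) ((1 - s) * a + s * b) by [].
exact: triple_convex.
Qed.

Theorem theorem4p1 (R : realType) (n N d : nat) (hd : (0 < d)%N) (hN : (0 < N)%N)
  (f : 'rV[R]_n -> \bar R) (hproper : proper_fun f) (hclosed : closed_fun f)
  (xbar : 'rV[R]_n) (hxbar : dom_subdiff f xbar)
  (A00 A0 : 'M[R]_d) (A : 'I_n -> 'M[R]_d) (B : 'I_N -> 'M[R]_d)
  (hA00 : A00^T = A00) (hA0 : A0^T = A0)
  (hA : forall i, (A i)^T = A i) (hB : forall j, (B j)^T = B j)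
  (hepi : epi f = [set p : 'rV[R]_n * R |
     exists u : 'rV[R]_N, psd (A00 + Astar A0 A B p.1 u p.2)])
  (hslater : exists (xs : 'rV[R]_n) (us : 'rV[R]_N) (ts : R),
     posdef (A00 + Astar A0 A B xs us ts))
  (hnonempty : lmi_fiber A00 A0 A B f xbar !=set0)
  (hcompact : compact (lmi_fiber A00 A0 A B f xbar))
  (hstrict : forall u : 'rV[R]_N, lmi_fiber A00 A0 A B f xbar u ->
     relint (subdiff (lmi_fun A00 A0 A B) (triple xbar u (fine (f xbar)))) 0) :
  KL_property f xbar (1 / 2).

  have fxb : f xbar = (fine (f xbar))%:E.
    have [z [fdom _]] := hxbar.
    by rewrite fineK // fin_real // lt_neqAle eq_sym hproper.1 leNye.
  set tb := fine (f xbar) in fxb.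
  have [ub hub] := hnonempty.
  pose zb := triple xbar ub tb.
  have [c c_gt0 growth] := relint_trace_growth hub (hstrict ub hub).
  have [K [eps [eps_gt0 bnd]]] := lmi_fiber_bounded hA00 hA0 hA hB hub hcompact.
  (* [e] selects the last coordinate, which is the objective. *)
  pose e : 'cV[R]_(n + N + 1) := col_mx 0 1%:M.
  have eE w : (w *m e) 0 0 = tpart w.
    by rewrite -{1}[w]hsubmxK mul_row_col mulmx0 add0r mulmx1.
  (* A bound on the displacement from [zb]: [eps] for the [x] and [t] coordinates, the rest for
     [u - ub]. *)
  pose K' := eps + `|K| + `|ub|.
  have K'_ge0 : 0 <= K' by rewrite !addr_ge0 // ltW.
  have growth' w : psd (A00 + lmi_map A0 A B zb + lmi_map A0 A B w) ->
      c * \tr (kermx (A00 + lmi_map A0 A B zb) *m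
        (A00 + lmi_map A0 A B zb + lmi_map A0 A B w) *m
        (kermx (A00 + lmi_map A0 A B zb))^T) <= (w *m e) 0 0.
    by rewrite eE; exact: growth.
  have [a [C [a_gt0 C_gt0 near_opt]]] := facial_growth hub
    (lmi_map_sym hA0 hA hB) c_gt0 K'_ge0 growth'.
  (* Closeness within [eps] keeps [u] bounded; [a] is the range of the error bound. *)
  apply: (@KL_half_of_growth _ _ f xbar C (Num.min eps a)) => //.
  - exact: sdp_representable_convex hepi.
  - by rewrite lt_min eps_gt0.
  move=> x t; rewrite lt_min -/tb => /andP[xeps _] fx t_gt t_lt.
  have [u xut] : exists u : 'rV[R]_N, lmi_set A00 A0 A B (triple x u t).
    by apply/(sdp_epi_feasible hepi); rewrite fx.
  have [t_eps t_a] : t - tb < eps /\ t - tb < a.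
    by apply/andP; rewrite -lt_min ltrBlDl.
  have uK : `|u| <= K by apply: bnd xut; rewrite // gtr0_norm ?subr_gt0.
  pose w := triple x u t - zb.
  have tw : tpart w = t - tb.
    by rewrite -(tpart_triple xbar ub tb) -(tpart_triple x u t) /w /tpart !mxE.
  have wE : w = triple (x - xbar) (u - ub) (t - tb).
    rewrite /w /zb -scaleN1r addrC -triple_lin !scaleN1r mulN1r.
    by rewrite (addrC _ x) (addrC _ u) (addrC _ t).
  have wK : `|w| <= K'.
    apply: mx_norm_le => // i j; rewrite wE ord1 /triple /K'.
    rewrite mxE; case: splitP => k _; last first.
      rewrite !ord1 mxE eqxx mulr1n gtr0_norm ?subr_gt0 //.
      by rewrite -addrA ler_wpDr ?addr_ge0 // ltW.
    rewrite mxE; case: splitP => l _; apply: le_trans (mx_coord_le _ _ _) _.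
      by rewrite -addrA ler_wpDr ?addr_ge0 // ltW.
    apply: le_trans (ler_normB _ _) _; rewrite lerD2r ler_wpDl ?(ltW eps_gt0) //.
    by apply: le_trans uK (ler_norm _).
  have feasD v : A00 + lmi_map A0 A B (zb + v) =
      A00 + lmi_map A0 A B zb + lmi_map A0 A B v.
    by rewrite linearD addrA.
  have psdw : psd (A00 + lmi_map A0 A B zb + lmi_map A0 A B w).
    by rewrite -feasD subrKC.
  have := near_opt w psdw wK; rewrite eE tw => /(_ (ltW t_a)).
  move=> [w' [psdw' tw' ww']].
  (* The point [zb + w'] is feasible with last coordinate [tb], so [f] is at most [tb] at its [x]
     part. *)
  exists (xpart (zb + w')).
    rewrite fxb; apply/(sdp_epi_feasible hepi); exists (upart (zb + w')).
    have -> : tb = tpart (zb + w').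
      by rewrite -[zb]scale1r tpartP -(eE w') tw' mul1r addr0 tpart_triple.
    by rewrite triple_eta lmi_setE feasD.
  (* Projecting onto the [x] coordinates does not increase the sup norm. *)
  apply: le_trans ww'; apply: mx_norm_le => // i j.
  have -> : (x - xpart (zb + w')) i j = (w - w') i (lshift 1 (lshift N j)).
    by rewrite -{1}(xpart_triple x u t) /w !mxE opprD addrA.
  exact: mx_coord_le.
Qed.
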